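(* Let $\rho>0$, $\beta\in(0,1)$, $x^0\in X$, and let $B\ge k$ be the bundle size of the limited-memory proximal bundle method (LM-PBM). Put $\gamma_\rho:=1-\beta/\max\{2,4\rho/\mu^*\}$ and $\theta_\rho:=L/(L+(1-\beta)\rho)$. For $0<\varepsilon<f(x^0)-f^*$, define $$S_\varepsilon:=\left\lceil\log_{1/\gamma_\rho}\frac{f(x^0)-f^*}{\beta\min\{1/2,\mu^*/(4\rho)\}\varepsilon}\right\rceil,\qquad P_\varepsilon:=\left\lceil\log_{1/\theta_\rho}\left((3-2\beta)^{S_\varepsilon}\max\left\{1,\frac{\|g(x^0)\|^2}{\min\{\rho,\mu^*/2\}\varepsilon}\right\}\right)\right\rceil .$$ Then LM-PBM with inputs $x^0,\rho,\beta,B$ reaches a serious center $x^t$ satisfying $f(x^t)-f^*\le\varepsilon$ after at most $$T_\varepsilon^{\text{LM-PBM}}=O\bigl(B(S_\varepsilon+P_\varepsilon)\bigr)$$ first-order oracle calls.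
   Context: Setting. $X\subseteq\mathbb R^n$ is a nonempty closed convex set, $f:X\to\mathbb R$ is convex, lower semicontinuous and attains its minimum $f^*=\min_{X}f$; $X^*=\operatorname{argmin}_X f$. $\|\cdot\|$, $\langle\cdot,\cdot\rangle$ are the Euclidean norm and inner product. For $x\in X$, $\partial f(x)=\{v\in\mathbb R^n: f(z)\ge f(x)+\langle v,z-x\rangle\ \forall z\in X\}$. A first-order oracle returns, at any $u\in X$, $f(u)$ and a subgradient $g(u)\in\partial f(u)$; $\ell_f(x;u):=f(u)+\langle g(u),x-u\rangle$ is the corresponding cutting plane. Piecewise smoothness. $k\in\mathbb N_+$, $L>0$, and $f$ is $(k,L)$-piecewise smooth: there are $k$ subsets $X_1,\dots,X_k$ of $X$ (pieces) covering $X$ such that each restriction $f|_{X_i}$ is $L$-smooth; this is used together with the oracle assumption that $f(x)-\ell_f(x;\bar x)\le\frac L2\|x-\bar x\|^2$ for all $i\in\{1,\dots,k\}$ and all $x,\bar x\in X_i$. Quadratic growth. $\mu^*:=\sup\{\nu>0: f(x)-f^*\ge\frac\nu2\operatorname{dist}^2(x,X^* )\ \forall x\in X\}$, and $0<\mu^*<\infty$ is assumed. LM-PBM. Input $x^0\in X$, $\rho>0$, $\beta\in(0,1)$, integer bundle size $B$. Set $\psi^0=\ell_f(\cdot;x^0)$ and $b=0$. For $t=0,1,\dots$ do one step: compute $y^t=\operatorname{argmin}_{x\in X}\{\psi^t(x)+\frac\rho2\|x-x^t\|^2\}$. If $f(x^t)-f(y^t)\ge\beta(f(x^t)-\psi^t(y^t))$,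 iteration $t$ is a serious step and $x^{t+1}=y^t$; otherwise it is a null step and $x^{t+1}=x^t$. If iteration $t$ is serious or $b=B$ (compression), set $a^t(x)=\psi^t(y^t)+\rho\langle x^t-y^t,x-y^t\rangle$, $\psi^{t+1}(x)=\max\{a^t(x),\ell_f(x;x^{t+1}),\ell_f(x;y^t)\}$, and $b\leftarrow0$. Otherwise set $\psi^{t+1}(x)=\max\{\psi^t(x),\ell_f(x;y^t)\}$ and $b\leftarrow b+1$. A serious center is a center $x^t$ produced by a serious step. The oracle is called once at $x^0$ and once at each trial point $y^t$. $O(\cdot)$ hides an absolute constant. *)

(* Defs.v *)
From HB Require Import structures.
From mathcomp Require Import all_boot all_order all_algebra.
From mathcomp Require Import all_classical all_reals all_analysis.

Set Implicit Arguments.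
Unset Strict Implicit.
Unset Printing Implicit Defensive.

Import Order.TTheory GRing.Theory Num.Theory.
Import numFieldNormedType.Exports.

Local Open Scope classical_set_scope.
Local Open Scope ring_scope.

(* MathComp-Analysis puts the sup norm on 'rV[R]_n. It induces the usual
   topology (used below through [closed] and [nbhs]), but metric quantities
   need the Euclidean norm, defined here. *)
Definition dotv (R : realType) (n : nat) (u v : 'rV[R]_n) : R :=
  \sum_(i < n) u 0 i * v 0 i.

Definition enorm (R : realType) (n : nat) (u : 'rV[R]_n) : R :=
  Num.sqrt (dotv u u).

Definition dist_to (R : realType) (n : nat) (u : 'rV[R]_n) (A : set 'rV[R]_n) : R :=
  inf [set enorm (u - a) | a in A].

(* Functions on X are total functions on R^n whose values outside X are
   never used. *)
Definition argmin (R : realType) (n : nat) (X : set 'rV[R]_n)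
    (h : 'rV[R]_n -> R) : set 'rV[R]_n :=
  [set y | X y /\ forall z, X z -> h y <= h z].

Definition minval (R : realType) (n : nat) (X : set 'rV[R]_n)
    (h : 'rV[R]_n -> R) : R :=
  inf (h @` X).

Definition subdifferential (R : realType) (n : nat) (X : set 'rV[R]_n)
    (f : 'rV[R]_n -> R) (x : 'rV[R]_n) : set 'rV[R]_n :=
  [set v | forall z, X z -> f x + dotv v (z - x) <= f z].

Definition first_order_oracle (R : realType) (n : nat) (X : set 'rV[R]_n)
    (f : 'rV[R]_n -> R) (g : 'rV[R]_n -> 'rV[R]_n) : Prop :=
  forall u, X u -> subdifferential X f u (g u).

Definition cutting_plane (R : realType) (n : nat) (f : 'rV[R]_n -> R)
    (g : 'rV[R]_n -> 'rV[R]_n) (u x : 'rV[R]_n) : R :=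
  f u + dotv (g u) (x - u).

(* Since S need not be open, differentiability at a point of S is relative
   to S, with some choice G of gradients that is L-Lipschitz on S. *)
Definition smooth_on (R : realType) (n : nat) (L : R) (S : set 'rV[R]_n)
    (f : 'rV[R]_n -> R) : Prop :=
  exists G : 'rV[R]_n -> 'rV[R]_n,
    (forall x, S x -> forall e, 0 < e ->
       \forall z \near within S (nbhs x),
         `|f z - f x - dotv (G x) (z - x)| <= e * enorm (z - x)) /\
    (forall x z, S x -> S z -> enorm (G x - G z) <= L * enorm (x - z)).

Definition piecewise_smooth (R : realType) (n k : nat) (L : R)
    (X : set 'rV[R]_n) (f : 'rV[R]_n -> R) (P : 'I_k -> set 'rV[R]_n) : Prop :=
  (forall i, P i `<=` X) /\ X `<=` \bigcup_i P i /\
  (forall i, smooth_on L (P i) f).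

Definition piecewise_oracle (R : realType) (n k : nat) (L : R)
    (f : 'rV[R]_n -> R) (g : 'rV[R]_n -> 'rV[R]_n)
    (P : 'I_k -> set 'rV[R]_n) : Prop :=
  forall i u x, P i u -> P i x ->
    f x - cutting_plane f g u x <= L / 2 * enorm (x - u) ^+ 2.

(* Extended-real valued, so that the supremum is meaningful when the set is
   empty (-oo) or unbounded (+oo). *)
Definition growth_modulus (R : realType) (n : nat) (X : set 'rV[R]_n)
    (f : 'rV[R]_n -> R) : \bar R :=
  ereal_sup [set nu%:E | nu in [set nu : R | 0 < nu /\
    forall x, X x ->
      nu / 2 * dist_to x (argmin X f) ^+ 2 <= f x - minval X f]].

(* (x^t, psi^t, b) at the beginning of iteration t *)
Record state (R : realType) (n : nat) := State {
  prox_center : 'rV[R]_n;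
  model : 'rV[R]_n -> R;
  bundle_count : nat }.

Definition init_state (R : realType) (n : nat) (f : 'rV[R]_n -> R)
    (g : 'rV[R]_n -> 'rV[R]_n) (x0 : 'rV[R]_n) : state R n :=
  State x0 (cutting_plane f g x0) 0.

Definition prox_objective (R : realType) (n : nat) (rho : R) (s : state R n)
    (x : 'rV[R]_n) : R :=
  model s x + rho / 2 * enorm (x - prox_center s) ^+ 2.

Definition serious (R : realType) (n : nat) (f : 'rV[R]_n -> R) (beta : R)
    (s : state R n) (y : 'rV[R]_n) : bool :=
  beta * (f (prox_center s) - model s y) <= f (prox_center s) - f y.

Definition aggregate (R : realType) (n : nat) (rho : R) (s : state R n)
    (y x : 'rV[R]_n) : R :=
  model s y + rho * dotv (prox_center s - y) (x - y).

(* The state after an iteration whose trial point is y. *)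
Definition next_state (R : realType) (n : nat) (f : 'rV[R]_n -> R)
    (g : 'rV[R]_n -> 'rV[R]_n) (rho beta : R) (B : nat) (s : state R n)
    (y : 'rV[R]_n) : state R n :=
  let c := if serious f beta s y then y else prox_center s in
  if serious f beta s y || (bundle_count s == B) then
    State c
      (fun x => Num.max (aggregate rho s y x)
                  (Num.max (cutting_plane f g c x) (cutting_plane f g y x)))
      0
  else
    State c (fun x => Num.max (model s x) (cutting_plane f g y x)) (bundle_count s).+1.

(* s t is the state at the beginning of iteration t, y t its trial point. *)
Definition lm_pbm (R : realType) (n : nat) (X : set 'rV[R]_n)
    (f : 'rV[R]_n -> R) (g : 'rV[R]_n -> 'rV[R]_n) (rho beta : R) (B : nat)
    (x0 : 'rV[R]_n) (s : nat -> state R n) (y : nat -> 'rV[R]_n) : Prop :=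
  s 0%N = init_state f g x0 /\
  forall t, argmin X (prox_objective rho (s t)) (y t) /\
            s t.+1 = next_state f g rho beta B (s t) (y t).

Definition serious_center (R : realType) (n : nat) (f : 'rV[R]_n -> R)
    (beta : R) (s : nat -> state R n) (y : nat -> 'rV[R]_n) (t : nat) : Prop :=
  exists2 r, t = r.+1 & serious f beta (s r) (y r).

(* Calls made by the time x^t is known: one at x^0 and one at each of
   y^0, ..., y^(t-1). *)
Definition oracle_calls (t : nat) : nat := t.+1.

Definition logb (R : realType) (b x : R) : R := ln x / ln b.

Definition gamma_rho (R : realType) (beta rho mu : R) : R :=
  1 - beta / Num.max 2 (4 * rho / mu).

Definition theta_rho (R : realType) (L beta rho : R) : R :=
  L / (L + (1 - beta) * rho).

Definition S_eps (R : realType) (beta rho mu gap0 eps : R) : int :=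
  Num.ceil (logb (gamma_rho beta rho mu)^-1
    (gap0 / (beta * Num.min (1 / 2) (mu / (4 * rho)) * eps))).

Definition P_eps (R : realType) (L beta rho mu gap0 normg0 eps : R) : int :=
  Num.ceil (logb (theta_rho L beta rho)^-1
    ((3 - 2 * beta) ^ S_eps beta rho mu gap0 eps *
     Num.max 1 (normg0 ^+ 2 / (Num.min rho (mu / 2) * eps)))).

(* Main.v *)
Require Import Defs.
From HB Require Import structures.
From mathcomp Require Import all_boot all_order all_algebra.
From mathcomp Require Import all_classical all_reals all_analysis.
From mathcomp Require Import ring lra zify.

(** Write x for the current center, psi for the current model, q for the
prox objective psi + rho/2 |. - x|^2 and gap(x) = f(x) - f^*.  Put
kappa = min(1/2, mu/(4 rho)), so that gamma = 1 - beta kappa, and measure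
progress by the prox gap, f(x) - min_X q.

Quadratic growth controls the gap by the prox gap.  Moving from x towards a
nearest minimizer shows that f(x) - min_X (f + rho/2 |. - x|^2) is at least
kappa gap(x) ([moreau_decrease]).  As psi <= f, the prox gap is at least
kappa gap(x), and so is the decrease f(x) - psi(y) predicted by the model; a
serious step achieves the fraction beta of it, hence multiplies the gap by at
most gamma ([serious_gap]).

The prox gap does not increase during null steps, because the model only
grows, up to aggregation, which by completing the square keeps the minimal
value of q.  Moreover, suppose that trial points u, then y, lie in one piece
and y gives a null step.  The cut at u is still in the model, so
f(y) - psi(y) <= L/2 |y - u|^2, while q is rho-strongly convex, so
rho/2 |y - u|^2 is at most the drop of the prox gap from u to y.  A null
step says that (1 - beta) times the prox gap is less than f(y) - psi(y);
together the prox gap has been multiplied by at most theta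
([null_contraction]).

Between two compressions without serious step there are B + 1 > k trial
points, so two of them share a piece: each full cycle multiplies the prox gap
by at most theta ([compression_step]).  A serious step may increase it, but by
at most the factor 3 - 2 beta ([serious_step]); initially it is at most
|g(x0)|^2 / (2 rho) ([cycle_inv_init]).

Hence after a serious steps and c full cycles, at a center with gap > eps,
  eps < gamma^a gap(x0)  and
  kappa eps < (3 - 2 beta)^a theta^c |g(x0)|^2 / (2 rho).
As 2 rho kappa = min(rho, mu/2), taking logarithms gives a < S_eps and
c < P_eps.  Counting cycles as closed by a compression at a null step or by
a serious step, each has at most B + 1 iterations, so at most
(B + 1) (a + c) + B iterations precede such a center ([trajectory_inv]).
So there is a first center with gap <= eps, and it differs from the previous
one, so it comes from a serious step. *)

Set Implicit Arguments.
Unset Strict Implicit.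
Unset Printing Implicit Defensive.

Import Order.TTheory GRing.Theory Num.Theory.
Import numFieldNormedType.Exports.

Local Open Scope classical_set_scope.
Local Open Scope ring_scope.

(** * Euclidean geometry *)

Section Euclid.
Variables (R : realType) (n : nat).
Implicit Types u v w x y z : 'rV[R]_n.

Lemma dotvC u v : dotv u v = dotv v u.
Proof. by apply: eq_bigr => i _; rewrite mulrC. Qed.

Lemma dotvDl u v w : dotv (u + v) w = dotv u w + dotv v w.
Proof.
by rewrite /dotv -big_split; apply: eq_bigr => i _; rewrite mxE mulrDl.
Qed.

Lemma dotvZl (a : R) u w : dotv (a *: u) w = a * dotv u w.
Proof.
by rewrite /dotv mulr_sumr; apply: eq_bigr => i _; rewrite mxE mulrA.
Qed.

Lemma dotvNl u w : dotv (- u) w = - dotv u w.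
Proof. by rewrite -scaleN1r dotvZl mulN1r. Qed.

Lemma dotvDr w u v : dotv w (u + v) = dotv w u + dotv w v.
Proof. by rewrite !(dotvC w) dotvDl. Qed.

Lemma dotvZr (a : R) w u : dotv w (a *: u) = a * dotv w u.
Proof. by rewrite !(dotvC w) dotvZl. Qed.

Lemma dotvNr w u : dotv w (- u) = - dotv w u.
Proof. by rewrite !(dotvC w) dotvNl. Qed.

Definition dotv_linear := (dotvDl, dotvDr, dotvNl, dotvNr, dotvZl, dotvZr).

Lemma dotv_ge0 u : 0 <= dotv u u.
Proof. by apply: sumr_ge0 => i _; rewrite -expr2 sqr_ge0. Qed.

Lemma sqr_enorm u : enorm u ^+ 2 = dotv u u.
Proof. by rewrite sqr_sqrtr ?dotv_ge0. Qed.

Lemma sqr_enorm0 : enorm (0 : 'rV[R]_n) ^+ 2 = 0.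
Proof. by rewrite sqr_enorm -(scale0r 0) dotvZl mul0r. Qed.

Lemma sqr_enormC u v : enorm (u - v) ^+ 2 = enorm (v - u) ^+ 2.
Proof. by rewrite -opprB !sqr_enorm dotvNl dotvNr opprK. Qed.

(** The negative term is the source of strong convexity of the prox
objective. *)
Lemma sqr_enorm_segment (t : R) x y z :
  enorm (t *: z + (1 - t) *: y - x) ^+ 2 =
  t * enorm (z - x) ^+ 2 + (1 - t) * enorm (y - x) ^+ 2
  - t * (1 - t) * enorm (z - y) ^+ 2.
Proof.
rewrite !sqr_enorm !dotv_linear (dotvC y z) (dotvC x z) (dotvC x y); ring.
Qed.

Lemma sqr_enorm_via x y z :
  enorm (z - x) ^+ 2 =
  enorm (z - y) ^+ 2 + enorm (y - x) ^+ 2 - 2 * dotv (x - y) (z - y).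
Proof.
rewrite !sqr_enorm !dotv_linear (dotvC y z) (dotvC x z) (dotvC x y); ring.
Qed.

(** The minimum over w of <v, w> + rho/2 |w|^2 is - |v|^2 / (2 rho): this
bounds from below the prox objective of an affine model. *)
Lemma completed_square_ge0 (rho : R) v w : 0 < rho ->
  0 <= (2 * rho)^-1 * dotv v v + dotv v w + rho / 2 * enorm w ^+ 2.
Proof.
move=> rho0.
have := dotv_ge0 (v + rho *: w).
rewrite sqr_enorm !dotv_linear (dotvC w v) => h.
have -> : (2 * rho)^-1 * dotv v v + dotv v w + rho / 2 * dotv w w =
  (2 * rho)^-1 * (dotv v v + rho * dotv v w
     + rho * (dotv v w + rho * dotv w w)).
  by field; rewrite gt_eqF.
by apply: mulr_ge0; [rewrite invr_ge0|]; lra.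
Qed.

End Euclid.

(** * Convexity along segments *)

Section Convexity.
Variables (R : realType) (n : nat) (X : set 'rV[R]_n).
Implicit Types (h : 'rV[R]_n -> R) (t : R).

Lemma convex_set_segment t x y : convex_set X -> 0 <= t -> t <= 1 ->
  X x -> X y -> X (t *: x + (1 - t) *: y).
Proof.
move=> cX t0 t1 Xx Xy.
have := cX x y (Itv01 t0 t1); rewrite !inE; exact.
Qed.

Lemma convex_functionP h : convex_function X h <->
  forall t x y, 0 <= t -> t <= 1 -> X x -> X y ->
    h (t *: x + (1 - t) *: y) <= t * h x + (1 - t) * h y.
Proof.
split=> [ch t x y t0 t1 Xx Xy|H t x y].
  have := ch (Itv01 t0 t1) x y; rewrite !inE; exact.
rewrite !inE => Xx Xy; apply: H => //.
Qed.

Lemma convex_function_max h1 h2 : convex_function X h1 ->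
  convex_function X h2 ->
  convex_function X (fun x => Num.max (h1 x) (h2 x)).
Proof.
move=> /convex_functionP c1 /convex_functionP c2.
apply/convex_functionP => t x y t0 t1 Xx Xy; rewrite ge_max.
have t1' : 0 <= 1 - t by rewrite subr_ge0.
apply/andP; split.
- apply: le_trans (c1 _ _ _ t0 t1 Xx Xy) _.
  by rewrite lerD ?ler_wpM2l// le_max lexx.
- apply: le_trans (c2 _ _ _ t0 t1 Xx Xy) _.
  by rewrite lerD ?ler_wpM2l// le_max lexx orbT.
Qed.

Lemma convex_function_affine (a : R) (v u : 'rV[R]_n) :
  convex_function X (fun x => a + dotv v (x - u)).
Proof.
apply/convex_functionP => t x y _ _ _ _.
by rewrite !dotv_linear; lra.
Qed.

End Convexity.

(** * Quadratic growth *)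

Section Growth.
Variables (R : realType) (n : nat) (X : set 'rV[R]_n) (f : 'rV[R]_n -> R).

Lemma minval_argmin a : argmin X f a -> minval X f = f a.
Proof.
move=> [Xa amin]; apply/eqP; rewrite eq_le; apply/andP; split.
  by apply: ge_inf; [exists (f a) => _ [z Xz <-]; exact: amin | exists a].
by apply: lb_le_inf; [exists (f a), a | move=> _ [z Xz <-]; exact: amin].
Qed.

Lemma dist_to_ge0 (x : 'rV[R]_n) A : A !=set0 -> 0 <= dist_to x A.
Proof.
move=> [a Aa]; apply: lb_le_inf; first by exists (enorm (x - a)), a.
by move=> _ [b _ <-]; exact: sqrtr_ge0.
Qed.

(** The supremum defining the modulus is attained: at each single x the
growth inequality is a closed condition on nu. *)
Lemma growth_modulus_attained x :
  (0 < growth_modulus X f)%E -> (growth_modulus X f < +oo)%E -> X x ->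
  fine (growth_modulus X f) / 2 * dist_to x (argmin X f) ^+ 2
    <= f x - minval X f.
Proof.
move=> mu0 muoo Xx.
have mufin : growth_modulus X f \is a fin_num.
  by rewrite fin_numE gt_eqF ?lt_eqF// (lt_trans _ mu0)// ltNyr.
set d2 := dist_to _ _ ^+ 2; set gap := _ - _.
have d20 : 0 <= d2 by exact: sqr_ge0.
rewrite leNgt; apply/negP => small.
have := mu0; rewrite -(fineK mufin) lte_fin => mu0'.
have d2gt0 : 0 < d2.
  rewrite lt_neqAle d20 andbT; apply/eqP => d2E.
  move: small; rewrite -d2E mulr0.
  have [_ [nu [nu0 /(_ x Xx) hnu] <-] _] := ereal_sup_gt mu0.
  move: hnu; rewrite -/d2 -d2E mulr0 -/gap => hnu /lt_le_trans /(_ hnu).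
  by rewrite ltxx.
have : ((2 * gap / d2)%:E < growth_modulus X f)%E.
  by rewrite -(fineK mufin) lte_fin ltr_pdivrMr//; lra.
case/ereal_sup_gt => _ [nu [_ /(_ x Xx) hnu] <-].
rewrite lte_fin ltr_pdivrMr// => lt_nu.
by move: hnu; rewrite -/d2 -/gap; lra.
Qed.

(** For a minimizer a, the point z = x + t (a - x) satisfies
f(z) <= f(x) - t gap, and quadratic growth bounds |z - x|^2 by
2 t^2 gap / mu when a is nearest to x.  The best t in [0, 1] is twice the
minimum of the conclusion.  E stands for f(x) minus a lower bound of the Moreau
envelope at x: both the predicted decrease and the prox gap are of this
form. *)
Lemma moreau_decrease (rho mu E : R) x :
  convex_set X -> convex_function X f -> argmin X f !=set0 ->
  0 < rho -> 0 < mu -> X x ->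
  mu / 2 * dist_to x (argmin X f) ^+ 2 <= f x - minval X f ->
  (forall z, X z -> f x - f z - rho / 2 * enorm (z - x) ^+ 2 <= E) ->
  Num.min (1 / 2) (mu / (4 * rho)) * (f x - minval X f) <= E.
Proof.
move=> cX /convex_functionP cf A0 rho0 mu0 Xx growth decr.
set gap := f x - minval X f; set d := dist_to _ _ in growth.
have [a0 A_a0] := A0.
have gap0 : 0 <= gap.
  by rewrite /gap (minval_argmin A_a0) subr_ge0; case: A_a0 => _; exact.
have d0 : 0 <= d by exact: dist_to_ge0.
(* The inequality for a segment towards any minimizer survives the infimum. *)
have along t : 0 < t -> t <= 1 -> t * gap - rho / 2 * t ^+ 2 * d ^+ 2 <= E.
  move=> t0 t1.
  have toward a : argmin X f a ->
      t * gap - E <= rho / 2 * t ^+ 2 * enorm (x - a) ^+ 2.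
    move=> A_a; have [Xa _] := A_a.
    have t0' := ltW t0.
    have := decr _ (convex_set_segment cX t0' t1 Xa Xx).
    have := cf _ _ _ t0' t1 Xa Xx.
    have -> : enorm (t *: a + (1 - t) *: x - x) ^+ 2 =
        t ^+ 2 * enorm (x - a) ^+ 2.
      by rewrite !sqr_enorm !dotv_linear (dotvC a x); ring.
    by rewrite /gap (minval_argmin A_a); lra.
  case: (lerP (t * gap) E) => [le_E|gt_E].
    apply: le_trans le_E; rewrite lerBlDr lerDl.
    by rewrite !mulr_ge0 ?sqr_ge0// ltW// divr_gt0.
  have c0 : 0 < rho / 2 * t ^+ 2 by rewrite mulr_gt0 ?exprn_gt0// divr_gt0.
  have : Num.sqrt ((t * gap - E) / (rho / 2 * t ^+ 2)) <= d.
    apply: lb_le_inf; first by exists (enorm (x - a0)), a0.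
    move=> _ [a A_a <-]; rewrite -[leRHS]ger0_norm ?sqrtr_ge0//.
    by rewrite -sqrtr_sqr ler_sqrt ?sqr_ge0// ler_pdivrMr// [leRHS]mulrC toward.
  rewrite -ler_sqr ?nnegrE ?sqrtr_ge0// sqr_sqrtr; last first.
    by rewrite divr_ge0// ltW// subr_gt0.
  by rewrite ler_pdivrMr// => ?; lra.
set kappa := Num.min _ _.
have rho4 : 0 < 4 * rho by rewrite mulr_gt0.
have kappa0 : 0 < kappa by rewrite lt_min !divr_gt0.
have kappa1 : kappa <= 1 / 2 by rewrite ge_min lexx.
have kappa_rho : kappa * (4 * rho) <= mu.
  by rewrite -ler_pdivlMr// ge_min lexx orbT.
(* The decrease t * gap - t^2 * rho * gap / mu is at least t * gap / 2
   as long as t * rho <= mu / 2; this t is the largest such in [0, 1]. *)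
have := along (2 * kappa) _ _; rewrite mulr_gt0// => /(_ isT) h.
apply: le_trans (h _); last by lra.
have : 2 * rho * kappa ^+ 2 * d ^+ 2 <= kappa * gap.
  have := ler_wpM2l (mulr_ge0 (ltW kappa0) (sqr_ge0 d)) kappa_rho.
  have := ler_wpM2l (ltW kappa0) growth.
  by rewrite -/gap; lra.
by lra.
Qed.

End Growth.

(** * One step of the method *)

Section BundleStep.
Variables (R : realType) (n k : nat) (X : set 'rV[R]_n) (f : 'rV[R]_n -> R).
Variables (g : 'rV[R]_n -> 'rV[R]_n) (P : 'I_k -> set 'rV[R]_n).
Variables (L rho beta : R) (B : nat).
Hypotheses (cX : convex_set X) (Xg : first_order_oracle X f g).
Hypotheses (L0 : 0 < L) (XP : X `<=` \bigcup_i P i).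
Hypothesis fP : piecewise_oracle L f g P.
Hypotheses (rho0 : 0 < rho) (beta1 : beta < 1) (kB : (k <= B)%N).
Implicit Types (s : state R n) (D : R).

Let theta := theta_rho L beta rho.

Definition valid_state s : Prop :=
  [/\ X (prox_center s), convex_function X (model s) &
      forall z, X z -> model s z <= f z].

(** The prox objective is rho-strongly convex: compare its values at y and at
y + t (z - y), divide by t and let t go to 0. *)
Lemma prox_objective_growth s y z : valid_state s ->
  argmin X (prox_objective rho s) y -> X z ->
  prox_objective rho s y + rho / 2 * enorm (z - y) ^+ 2
    <= prox_objective rho s z.
Proof.
move=> [Xc /convex_functionP cm _] [Xy ymin] Xz.
rewrite -lerBrDl.
set q := enorm (z - y) ^+ 2; set gap := _ - _.
have q0 : 0 <= q by exact: sqr_ge0.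
have segment t : 0 < t -> t <= 1 -> rho / 2 * q * (1 - t) <= gap.
  move=> t0 t1; have t0' := ltW t0.
  have := ymin _ (convex_set_segment cX t0' t1 Xz Xy).
  have := cm _ _ _ t0' t1 Xz Xy.
  rewrite /gap /prox_objective sqr_enorm_segment -/q => conv min_y.
  by rewrite -(ler_pM2l t0); lra.
have rq0 : 0 <= rho / 2 * q by rewrite mulr_ge0// divr_ge0// ltW.
apply/ler_addgt0Pr => e e0.
(* Letting t go to 0 in the segment inequality, up to the slack e. *)
have t0 : 0 < e / (rho / 2 * q + e) by rewrite divr_gt0// ltr_wpDl.
have t1 : e / (rho / 2 * q + e) <= 1.
  by rewrite ler_pdivrMr ?ltr_wpDl// mul1r lerDr.
have := segment _ t0 t1.
have : rho / 2 * q * (e / (rho / 2 * q + e)) <= e.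
  rewrite mulrA ler_pdivrMr ?ltr_wpDl// mulrC ler_wpM2l// ?(ltW e0)//.
  by rewrite lerDl ltW.
by lra.
Qed.

(** The aggregate is the affine function whose prox objective is the
quadratic of curvature rho touching the old prox objective at y.  With
[prox_objective_growth], it lies below the old model on X, and replacing the
model by it keeps the minimal value of the prox objective. *)
Lemma aggregate_prox s y z :
  aggregate rho s y z + rho / 2 * enorm (z - prox_center s) ^+ 2 =
  prox_objective rho s y + rho / 2 * enorm (z - y) ^+ 2.
Proof.
rewrite /aggregate /prox_objective (sqr_enorm_via (prox_center s) y z); lra.
Qed.

Lemma cutting_plane_le u z : X u -> X z -> cutting_plane f g u z <= f z.
Proof. by move=> Xu; exact: Xg. Qed.

Lemma valid_init x0 : X x0 -> valid_state (init_state f g x0).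
Proof.
split=> //=; first exact: convex_function_affine.
by move=> z; exact: cutting_plane_le.
Qed.

Lemma valid_next s y : valid_state s -> argmin X (prox_objective rho s) y ->
  valid_state (next_state f g rho beta B s y).
Proof.
move=> vs ymin; have [Xc cm mf] := vs; have [Xy _] := ymin.
have agg z : X z -> aggregate rho s y z <= f z.
  move=> Xz; apply: le_trans (mf _ Xz).
  have := prox_objective_growth vs ymin Xz; rewrite -aggregate_prox.
  by rewrite /prox_objective lerD2r.
have Xc' : X (if serious f beta s y then y else prox_center s) by case: ifP.
rewrite /next_state; case: ifP => _; split=> //=.
- apply: convex_function_max; last first.
    by apply: convex_function_max; exact: convex_function_affine.
  have -> : aggregate rho s y = fun x =>
      model s y + dotv (rho *: (prox_center s - y)) (x - y).
    by apply/funext => x; rewrite dotvZl.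
  exact: convex_function_affine.
- by move=> z Xz; rewrite !ge_max agg//= !cutting_plane_le.
- by apply: convex_function_max => //; exact: convex_function_affine.
- by move=> z Xz; rewrite ge_max mf// cutting_plane_le.
Qed.

(** Bounds the prox gap by D; quantifying over X avoids naming the trial
point, which is only chosen in the next step. *)
Definition prox_gap_le s D : Prop :=
  forall z, X z -> f (prox_center s) - D <= prox_objective rho s z.

(** The current cycle has had a trial point u in piece i.  What remains of it
in the state is its cut and, by strong convexity, a quadratic lower bound
around u for the prox objective, which is preserved as the model grows. *)
Definition visited s D (i : 'I_k) : Prop :=
  exists2 u, P i u & forall z, X z ->
    cutting_plane f g u z <= model s z /\
    f (prox_center s) - D + rho / 2 * enorm (z - u) ^+ 2
      <= prox_objective rho s z.

(** D bounds the prox gap since the start of the cycle.  Either the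
contraction due in this cycle has already happened, or the trial points of the
cycle lie in pairwise different pieces, collected in I. *)
Definition cycle_inv s D : Prop :=
  prox_gap_le s D /\
  (prox_gap_le s (theta * D) \/
   exists2 I : {set 'I_k}, #|I| = bundle_count s &
     forall i, i \in I -> visited s D i).

Lemma cycle_inv_start s D : bundle_count s = 0%N -> prox_gap_le s D ->
  cycle_inv s D.
Proof.
move=> b0 gapD; split=> //; right.
exists finset.set0; first by rewrite cards0 b0.
by move=> i; rewrite finset.in_set0.
Qed.

(** Two trial points in the same piece.  With delta the prox gap at y and
q = |y - u|^2, the failed descent test and the oracle inequality give
(1 - beta) delta <= L/2 q, the quadratic bound around u gives
rho/2 q <= D - delta; eliminate q. *)
Lemma null_contraction s D y i : valid_state s ->
  argmin X (prox_objective rho s) y -> ~~ serious f beta s y ->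
  visited s D i -> P i y -> prox_gap_le s (theta * D).
Proof.
move=> vs [Xy ymin] null0 [u Pu /(_ _ Xy) [cut_u near_u]] Py z Xz.
apply: le_trans (ymin _ Xz).
move: null0 near_u cut_u; have := fP Pu Py.
rewrite /serious -ltNge /prox_objective.
set q := enorm (y - u) ^+ 2; set p := enorm _ ^+ 2.
set fc := f (prox_center s); set m := model s y => smooth null near_u cut_u.
have p0 : 0 <= rho / 2 * p by rewrite mulr_ge0 ?sqr_ge0// divr_ge0// ltW.
have b1 : 0 < (1 - beta) * rho by rewrite mulr_gt0// subr_gt0.
have null' : (1 - beta) * (fc - m) <= L / 2 * q by lra.
have delta : (1 - beta) * (fc - (m + rho / 2 * p)) <= L / 2 * q.
  apply: le_trans null'; rewrite ler_wpM2l ?subr_ge0 ?(ltW beta1)//; lra.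
have := ler_wpM2l (ltW L0) near_u; have := ler_wpM2l (ltW rho0) delta.
move=> scaled_delta scaled_near.
rewrite /theta /theta_rho lerBlDr -lerBlDl [leRHS]mulrAC.
by rewrite ler_pdivlMr ?addr_gt0//; lra.
Qed.

Lemma null_step s D y : valid_state s ->
  argmin X (prox_objective rho s) y -> ~~ serious f beta s y ->
  bundle_count s != B -> cycle_inv s D ->
  cycle_inv (next_state f g rho beta B s y) D.
Proof.
move=> vs ymin null bB [gapD alt]; have [Xy _] := ymin.
rewrite /next_state (negPf null) (negPf bB)/=; set s' := State _ _ _.
have grow z : model s z <= model s' z by rewrite /= le_max lexx.
have growp z : prox_objective rho s z <= prox_objective rho s' z.
  by rewrite /prox_objective lerD2r.
split; first by move=> z Xz; exact: le_trans (gapD _ Xz) _.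
case: alt => [gapT|[I cardI visI]].
  by left=> z Xz; exact: le_trans (gapT _ Xz) _.
have [i _ Py] := XP Xy.
have [iI|iI] := boolP (i \in I).
  left=> z Xz; apply: le_trans (growp z).
  exact: null_contraction vs ymin null (visI _ iI) Py _ Xz.
right; exists (i |: I)%SET; first by rewrite cardsU1 iI cardI.
move=> j; rewrite in_setU1 => /orP[/eqP ->|jI].
  exists y => // z Xz; split; first by rewrite /= le_max lexx orbT.
  apply: le_trans (growp z); apply: le_trans (prox_objective_growth vs ymin Xz).
  by rewrite lerD2r; exact: gapD.
have [u Pu visu] := visI _ jI; exists u => // z Xz.
have [cut_u near_u] := visu _ Xz.
by split; [exact: le_trans cut_u _ | exact: le_trans near_u _].
Qed.

Lemma compression_step s D y : valid_state s ->
  argmin X (prox_objective rho s) y -> ~~ serious f beta s y ->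
  bundle_count s = B -> cycle_inv s D ->
  cycle_inv (next_state f g rho beta B s y) (theta * D).
Proof.
move=> vs ymin null bB [_ alt]; have [Xy _] := ymin.
rewrite /next_state (negPf null) bB eqxx/=; apply: cycle_inv_start => //.
have gapT : prox_gap_le s (theta * D).
  case: alt => [//|[I cardI visI]].
  have [i _ Py] := XP Xy.
  (* All k pieces are visited since #|I| = B >= k, hence so is that of y. *)
  have II : I = [set: _]%SET.
    by apply/eqP; rewrite eqEcard finset.subsetT cardsT card_ord cardI bB.
  by apply: (null_contraction vs ymin null (visI i _) Py); rewrite II inE.
move=> z Xz; apply: le_trans (gapT y Xy) _ => /=.
rewrite [leRHS]/prox_objective/=.
apply: (@le_trans _ _ (prox_objective rho s y + rho / 2 * enorm (z - y) ^+ 2)).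
  by rewrite lerDl mulr_ge0 ?sqr_ge0// divr_ge0// ltW.
by rewrite -aggregate_prox lerD2r le_max lexx.
Qed.

(** Let p = |y - x|^2 for the old center x.  The aggregate alone makes the
new prox gap at most f(y) - psi(y) + rho/2 p.  The descent test bounds
f(y) - psi(y) by (1 - beta) (D + rho/2 p), and strong convexity between y and
x, where psi(x) <= f(x), gives rho/2 p <= D. *)
Lemma serious_step s D y : valid_state s ->
  argmin X (prox_objective rho s) y -> serious f beta s y ->
  cycle_inv s D ->
  cycle_inv (next_state f g rho beta B s y) ((3 - 2 * beta) * D).
Proof.
move=> vs ymin ser [gapD _]; have [Xy _] := ymin; have [Xc _ mf] := vs.
rewrite /next_state ser/=; apply: cycle_inv_start => //= z Xz.
rewrite /prox_objective/=.
apply: (@le_trans _ _ (aggregate rho s y z + rho / 2 * enorm (z - y) ^+ 2)).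
  2: by rewrite lerD2r le_max lexx.
have := gapD y Xy; have := mf _ Xc.
have := prox_objective_growth vs ymin Xc.
have := completed_square_ge0 (rho *: (prox_center s - y)) (z - y) rho0.
move: ser; rewrite /serious /prox_objective /aggregate subrr sqr_enorm0.
rewrite (sqr_enormC y).
rewrite !(dotvZl, dotvZr) -sqr_enorm.
set p := enorm _ ^+ 2; set w := enorm _ ^+ 2; set d := dotv _ _.
have -> : (2 * rho)^-1 * (rho * (rho * p)) = rho / 2 * p.
  by field; rewrite gt_eqF.
set fc := f (prox_center s); set m := model s y => ser sq growth le_fc gap.
have b1 : 0 < 1 - beta by rewrite subr_gt0.
have : (1 - beta) * (rho / 2 * p) <= (1 - beta) * D.
  by rewrite ler_wpM2l ?(ltW b1)//; lra.
have : (1 - beta) * (fc - m) <= (1 - beta) * (D + rho / 2 * p).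
  by rewrite ler_wpM2l ?(ltW b1)//; lra.
by lra.
Qed.

Lemma cycle_inv_init x0 :
  cycle_inv (init_state f g x0) (enorm (g x0) ^+ 2 / (2 * rho)).
Proof.
apply: cycle_inv_start => // z _.
rewrite /prox_objective /= /cutting_plane sqr_enorm.
by have := completed_square_ge0 (g x0) (z - x0) rho0; lra.
Qed.

End BundleStep.

(** * Counting iterations *)

Lemma lt_ceil_logb (R : realType) (b x : R) (m : nat) : 1 < b -> b ^+ m < x ->
  m%:Z < Num.ceil (logb b x).
Proof.
move=> b1 bm_lt; rewrite ceil_gt_int /logb.
have b0 : 0 < b by apply: lt_trans b1.
have bm0 : 0 < b ^+ m by rewrite exprn_gt0.
rewrite ltr_pdivlMr ?ln_gt0// -pmulrn mulr_natl -lnXn//.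
by rewrite ltr_ln ?posrE// (lt_trans bm0).
Qed.

Lemma iterations_le_cycles (t a c b B : nat) (S P : int) :
  a%:Z < S -> c%:Z < P -> (b <= B)%N -> (t <= B.+1 * (a + c) + b)%N ->
  t.+2%:Z <= B.+1%:Z * (S + P).
Proof.
move=> aS cP bB tle.
have le_SP : (a + c).+2%:Z <= S + P by lia.
apply: le_trans (ler_wpM2l _ le_SP) => //; rewrite -PoszM lez_nat !mulnS.
by clear -tle bB; lia.
Qed.

Section Trajectory.
Variables (R : realType) (n k : nat) (X : set 'rV[R]_n) (f : 'rV[R]_n -> R).
Variables (g : 'rV[R]_n -> 'rV[R]_n) (P : 'I_k -> set 'rV[R]_n).
Variables (L rho beta : R) (B : nat).
Variables (x0 : 'rV[R]_n) (s : nat -> state R n) (y : nat -> 'rV[R]_n).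
Hypotheses (cX : convex_set X) (cf : convex_function X f).
Hypotheses (X_f : argmin X f !=set0) (Xg : first_order_oracle X f g).
Hypotheses (L0 : 0 < L) (XP : X `<=` \bigcup_i P i).
Hypothesis fP : piecewise_oracle L f g P.
Hypotheses (mu0 : (0 < growth_modulus X f)%E).
Hypotheses (muoo : (growth_modulus X f < +oo)%E).
Hypotheses (rho0 : 0 < rho) (beta0 : 0 < beta) (beta1 : beta < 1).
Hypotheses (X_x0 : X x0) (kB : (k <= B)%N).
Hypothesis run : lm_pbm X f g rho beta B x0 s y.

Let mu := fine (growth_modulus X f).
Let kappa := Num.min (1 / 2) (mu / (4 * rho)).
Let gap x := f x - minval X f.
Let gamma := gamma_rho beta rho mu.
Let theta := theta_rho L beta rho.

Let mu_gt0 : 0 < mu.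
Proof. by rewrite fine_gt0// mu0. Qed.

Lemma gamma_rhoE : gamma = 1 - beta * kappa.
Proof.
rewrite /gamma /gamma_rho /kappa; congr (1 - beta * _).
have mu4 : 0 < mu / (4 * rho) by rewrite divr_gt0 ?mulr_gt0.
have -> : 4 * rho / mu = (mu / (4 * rho))^-1 by rewrite invf_div.
have half : (1 / 2)^-1 = 2 :> R by rewrite invf_div divr1.
have [le_mu|/ltW le_mu] := leP (1 / 2) (mu / (4 * rho)).
  rewrite max_l; first by rewrite div1r.
  by rewrite -[leRHS]half lef_pV2 ?posrE.
rewrite max_r ?invrK//.
by rewrite -[leLHS]half lef_pV2 ?posrE.
Qed.

Let kappa_gt0 : 0 < kappa.
Proof. by rewrite lt_min !divr_gt0// mulr_gt0. Qed.

Let kappa_le_half : kappa <= 1 / 2.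
Proof. by rewrite ge_min lexx. Qed.

Lemma gamma_rho_itv : 0 < gamma < 1.
Proof.
rewrite gamma_rhoE; have := mulr_gt0 beta0 kappa_gt0.
have := ler_pM (ltW beta0) (ltW kappa_gt0) (ltW beta1) kappa_le_half.
by lra.
Qed.

Lemma gap_le_predicted E x : X x ->
  (forall z, X z -> f x - f z - rho / 2 * enorm (z - x) ^+ 2 <= E) ->
  kappa * gap x <= E.
Proof.
move=> Xx; apply: moreau_decrease => //.
exact: growth_modulus_attained.
Qed.

Lemma serious_gap st z : valid_state X f st ->
  argmin X (prox_objective rho st) z -> serious f beta st z ->
  gap z <= gamma * gap (prox_center st).
Proof.
move=> [Xc _ mf] [Xz zmin] ser.
have : kappa * gap (prox_center st) <= f (prox_center st) - model st z.
  apply: gap_le_predicted => // w Xw.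
  have := zmin _ Xw; have := mf _ Xw; rewrite /prox_objective.
  have : 0 <= rho / 2 * enorm (z - prox_center st) ^+ 2.
    by rewrite mulr_ge0 ?sqr_ge0// divr_ge0// ltW.
  by lra.
move/(ler_wpM2l (ltW beta0)) => pred.
by rewrite gamma_rhoE; move: ser pred; rewrite /serious /gap; lra.
Qed.

Lemma gap_le_prox_gap st D : valid_state X f st -> prox_gap_le X f rho st D ->
  kappa * gap (prox_center st) <= D.
Proof.
move=> [Xc _ mf] gapD; apply: gap_le_predicted => // z Xz.
by have := gapD _ Xz; have := mf _ Xz; rewrite /prox_objective; lra.
Qed.

(** Here a counts the serious steps and c the full cycles, ended by a
compression at a null step.  Since either event resets the bundle, at most
B + 1 iterations separate consecutive ones. *)
Lemma trajectory_inv t : exists a c : nat,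
  [/\ valid_state X f (s t) /\
      cycle_inv X f g P L rho beta (s t)
        ((3 - 2 * beta) ^+ a * theta ^+ c * (enorm (g x0) ^+ 2 / (2 * rho))),
      (bundle_count (s t) <= B)%N,
      (t <= B.+1 * (a + c) + bundle_count (s t))%N &
      gap (prox_center (s t)) <= gamma ^+ a * gap x0].
Proof.
elim: t => [|t [a [c [[vs inv] bB tle gap_le]]]].
  have [-> _] := run; exists 0%N, 0%N; split=> //; last by rewrite mul1r.
  by rewrite !mul1r; split; [exact: valid_init | exact: cycle_inv_init].
have [_ /(_ t) [ymin sE]] := run.
have vs' := valid_next beta B cX Xg rho0 vs ymin; rewrite -sE in vs'.
have [ser|null] := boolP (serious f beta (s t) (y t)).
  exists a.+1, c; split.
  - split=> //; rewrite exprS -!(mulrA (3 - 2 * beta)) sE.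
    exact: serious_step.
  - by rewrite sE /next_state ser.
  - by rewrite sE /next_state ser/=; move: tle bB; clear; lia.
  - rewrite sE /next_state ser/= exprS -mulrA.
    apply: le_trans (serious_gap vs ymin ser) _.
    by rewrite ler_wpM2l// ltW//; case/andP: gamma_rho_itv.
have [bBE|bB'] := eqVneq (bundle_count (s t)) B.
  exists a, c.+1; split.
  - split=> //; rewrite exprS (mulrCA (_ ^+ a) theta) -(mulrA theta) sE.
    exact: compression_step.
  - by rewrite sE /next_state (negPf null) bBE eqxx.
  - by move: tle; rewrite sE /next_state (negPf null) bBE eqxx/=; clear; lia.
  - by rewrite sE /next_state (negPf null) bBE eqxx.
exists a, c; split.
- by split=> //; rewrite sE; exact: null_step.
- rewrite sE /next_state (negPf null) (negPf bB')/=.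
  by rewrite ltn_neqAle bB' bB.
- by move: tle; rewrite sE /next_state (negPf null) (negPf bB')/=; clear; lia.
- by rewrite sE /next_state (negPf null) (negPf bB').
Qed.

(** The bound comes from the predecessor of the first center with gap <= eps,
where both logarithmic estimates hold with strict inequality: this leaves room
for the iteration that leads to the good center and for the call at x0. *)
Lemma oracle_complexity eps : 0 < eps -> eps < gap x0 ->
  let Seps := S_eps beta rho mu (gap x0) eps in
  let Peps := P_eps L beta rho mu (gap x0) (enorm (g x0)) eps in
  exists t, [/\ serious_center f beta s y t,
    gap (prox_center (s t)) <= eps &
    (oracle_calls t)%:Z <= B.+1%:Z * (Seps + Peps)].
Proof.
move=> eps0 eps_lt Seps Peps.
have /andP[gamma0 gamma1] := gamma_rho_itv.
have b1 : 0 < (1 - beta) * rho by rewrite mulr_gt0 ?subr_gt0.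
have theta0 : 0 < theta by rewrite divr_gt0// addr_gt0.
have theta1 : theta < 1 by rewrite ltr_pdivrMr ?addr_gt0// mul1r ltrDl.
have b3 : 1 <= 3 - 2 * beta by have := beta1; lra.
have not_yet t : eps < gap (prox_center (s t)) ->
    t.+2%:Z <= B.+1%:Z * (Seps + Peps).
  move=> gap_gt; have [a [c [[vs [gapD _]] bB tle gap_le]]] := trajectory_inv t.
  have a_lt : a%:Z < Seps.
    apply: lt_ceil_logb; first by rewrite invf_gt1.
    rewrite exprVn ltr_pdivlMr; last by rewrite !mulr_gt0.
    rewrite ltr_pdivrMl ?exprn_gt0// -/kappa.
    apply: le_lt_trans (lt_le_trans gap_gt gap_le).
    rewrite ler_piMl ?(ltW eps0)//.
    by move: gamma0; rewrite gamma_rhoE subr_gt0 => /ltW.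
  have c_lt : c%:Z < Peps.
    apply: lt_ceil_logb; first by rewrite invf_gt1.
    have D_gt := lt_le_trans _ (gap_le_prox_gap vs gapD).
    have {D_gt} := D_gt (kappa * eps); rewrite ltr_pM2l// => /(_ gap_gt).
    rewrite -/theta -/Seps exprVn.
    set G := enorm (g x0) ^+ 2 => D_gt.
    (* The denominator in P_eps is 2 * rho * kappa * eps. *)
    have -> : Num.min rho (mu / 2) = 2 * rho * kappa.
      rewrite /kappa; have [le_mu|/ltW le_mu] := leP (1 / 2) (mu / (4 * rho)).
        rewrite min_l; first by lra.
        by move: le_mu; rewrite ler_pdivlMr ?mulr_gt0//; lra.
      rewrite min_r; first by field; rewrite gt_eqF.
      by move: le_mu; rewrite ler_pdivrMr ?mulr_gt0//; lra.
    have denom : 0 < 2 * rho * kappa * eps by rewrite !mulr_gt0.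
    have start : (theta ^+ c)^-1 <
        (3 - 2 * beta) ^+ a * (G / (2 * rho * kappa * eps)).
      rewrite -div1r ltr_pdivrMr ?exprn_gt0// mulrA mulrAC ltr_pdivlMr//.
      rewrite mul1r; move: D_gt; rewrite !mulrA ltr_pdivlMr ?mulr_gt0//; lra.
    apply: lt_le_trans start _; case: Seps a_lt => // S; rewrite ltz_nat => aS.
    rewrite ler_pM ?exprn_ge0 ?divr_ge0 ?sqr_ge0 ?(ltW denom)//.
    - by lra.
    - by rewrite ler_weXn2l// ltnW.
    - by rewrite le_max lexx orbT.
  exact: iterations_le_cycles a_lt c_lt bB tle.
have ex_t : exists t, gap (prox_center (s t)) <= eps.
  apply/not_existsP => big.
  move: not_yet; move: (_ * _) => M not_yet.
  have := not_yet `|M|%N; rewrite ltNge => /(_ (introT negP (big _))) le_M.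
  by have := le_trans le_M (lez_abs M); rewrite lez_nat => /ltnW; rewrite ltnn.
(* The first good center is not x0 and differs from its predecessor. *)
case: (ex_minnP ex_t) => -[|t].
  by have [-> _] := run; rewrite leNgt eps_lt.
move=> gap_le min_t; have gap_gt : eps < gap (prox_center (s t)).
  by rewrite ltNge; apply/negP => /min_t; rewrite ltnn.
exists t.+1; split; [|exact: gap_le|exact: not_yet].
exists t => //; apply: contraTT gap_gt => null; rewrite -leNgt.
apply: le_trans gap_le; have [_ /(_ t) [_ ->]] := run.
by rewrite /next_state (negPf null); case: ifP.
Qed.

End Trajectory.

Theorem theorem5p2 :
  exists C : nat,
  forall (R : realType) (n : nat) (X : set 'rV[R]_n) (f : 'rV[R]_n -> R)
    (g : 'rV[R]_n -> 'rV[R]_n) (k : nat) (L : R) (P : 'I_k -> set 'rV[R]_n)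
    (rho beta : R) (x0 : 'rV[R]_n) (B : nat)
    (s : nat -> state R n) (y : nat -> 'rV[R]_n) (eps : R),
  X !=set0 -> closed X -> convex_set X ->
  convex_function X f ->
  lower_semicontinuous (fun x : subspace X => (f x)%:E) ->
  argmin X f !=set0 ->
  first_order_oracle X f g ->
  (0 < k)%N -> 0 < L ->
  piecewise_smooth L X f P ->
  piecewise_oracle L f g P ->
  (0 < growth_modulus X f)%E -> (growth_modulus X f < +oo)%E ->
  0 < rho -> 0 < beta -> beta < 1 -> X x0 -> (k <= B)%N ->
  lm_pbm X f g rho beta B x0 s y ->
  0 < eps -> eps < f x0 - minval X f ->
  let mu := fine (growth_modulus X f) in
  let gap0 := f x0 - minval X f in
  let Seps := S_eps beta rho mu gap0 eps in
  let Peps := P_eps L beta rho mu gap0 (enorm (g x0)) eps in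
  exists t : nat,
    serious_center f beta s y t /\
    f (prox_center (s t)) - minval X f <= eps /\
    (oracle_calls t)%:R <= C%:R * (B%:R * (Seps + Peps)%:~R) :> R.
Proof.
(* 2 absorbs B + 1 <= 2 B. *)
exists 2%N => R n X f g k L P rho beta x0 B s y eps _ _ cX cf _ X_f Xg k0 L0.
move=> [_ [XP _]] fP mu0 muoo rho0 beta0 beta1 X_x0 kB run eps0 eps_lt.
move=> mu gap0 Seps Peps.
have [t [center small calls]] := oracle_complexity cX cf X_f Xg L0 XP fP mu0
  muoo rho0 beta0 beta1 X_x0 kB run eps0 eps_lt.
exists t; split=> //; split=> //.
have B0 : (0 < B)%N by exact: leq_trans kB.
have SP_ge0 : 0 <= Seps + Peps.
  have : 0 < B.+1%:Z * (Seps + Peps) by exact: lt_le_trans calls.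
  by rewrite pmulr_rgt0// => /ltW.
have calls2 : (oracle_calls t)%:Z <= (2 * B)%N%:Z * (Seps + Peps).
  apply: le_trans calls _.
  by rewrite ler_wpM2r// lez_nat mul2n -addnn -addn1 leq_add2l.
by move: calls2; rewrite -(ler_int R) intrM PoszM intrM -mulrA.
Qed.
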